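(* Let $D$ be a division $p$-algebra with $\operatorname{char}D=p>2$ and with centre $Z(D)=F$. Suppose $Z(\bar D)=\bar D$ and $\bar D/\bar F$ is a simple purely inseparable extension, $\bar D=\bar F(a)$. Suppose that the semilocal height $i(u)$, which does not depend on the embedding $u$ in this case, is not divisible by $p$. Then $d_D(a)>i(u)$.
   Context: Let $k$ be a field of characteristic $p$, $F=k((t))$, and let $D$ be a division algebra finite dimensional over its centre $F$; $D$ is a $p$-algebra, i.e. its index is a power of $p=\operatorname{char}D$. The $t$-adic valuation extends uniquely to a valuation $w$ on $D$, normalized so that its value group $\Gamma_D$ is $\mathbb Z$. $V_D$, $M_D$, $\bar D=V_D/M_D$ denote valuation ring, maximal ideal and residue division ring (similarly for $F$). A parameter of $D$ is an element $z$ with $w(z)=1$. An embedding $u:\bar D\hookrightarrow D$ is a ring homomorphism $\bar D\to V_D$ that is a section of the residue map; $D$ is splittable if one exists. (The algebra $D$ in the statement is splittable.) Given a parameter $z$ and an embedding $u$, every element of $D$ is uniquely a convergent series $\sum_{j\ge N}u(a_j)z^j$ with $a_j\in\bar D$. Define the automorphism $\alpha={}^{(z)}\alpha$ of $\bar D$ and maps ${}^{(z,u)}_m\delta_i:\bar D\to\bar D$ ($m\in\mathbb Z$, $i\ge1$) by $$z^mu(b)z^{-m}=u(\alpha^m(b))+u({}^{(z,u)}_m\delta_1(b))z+u({}^{(z,u)}_m\delta_2(b))z^2+\cdots,\qquad b\in\bar D,$$ and ${}^{(z,u)}\delta_i={}^{(z,u)}_1\delta_i$. In the situation of the statement $\alpha=\mathrm{id}$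 for every $z$. The local height is $i(u,z)=\min_{b\in\bar D}w(zu(b)z^{-1}-u(b))$. A parameter $z$ is called appropriate (for $u$) if ${}^{(z,u)}\delta_{i(u,z)}|_{Z(\bar D)}\neq0$. The semilocal height is $i(u)=\max_z i(u,z)$, equal to $i(u,z)$ for an appropriate parameter $z$. For $b\in Z(\bar D)$ with $\alpha(b)=b$, $i(u,b)$ denotes the minimal positive integer $i$ with ${}^{(z,u)}\delta_i(b)\ne0$, i.e. $i(u,b)=w(zu(b)z^{-1}-u(b))$; it does not depend on $z$. Finally, $$d_D(a)=\max_{u,z}\,w\Bigl(z^{-i(u,a)}u(a)z^{i(u,a)}-u(a)-u\bigl({}^{(z,u)}_{-i(u,a)}\delta_{i(u,a)}(a)\bigr)z^{i(u,a)}\Bigr)\in\mathbb N\cup\{\infty\},$$ where $u$ runs over embeddings and $z$ over appropriate parameters. *)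

(* Defs.v *)
From HB Require Import structures.
From mathcomp Require Import all_boot all_order all_algebra all_field.
From mathcomp Require Import boolp classical_sets functions cardinality fsbigop.
From mathcomp Require Import constructive_ereal.
From mathcomp Require Import zify.

Set Implicit Arguments.
Unset Strict Implicit.
Unset Printing Implicit Defensive.

Import Order.TTheory GRing.Theory Num.Theory.

Local Open Scope classical_set_scope.
Local Open Scope ring_scope.
Local Open Scope quotient_scope.

(* k((t)): f n is the coefficient of t^n. *)
Record laurent (k : fieldType) := Laurent {
  lcoef :> int -> k;
  lcoef_bounded : exists N : int, forall n, n < N -> lcoef n = 0 }.

HB.instance Definition _ (k : fieldType) := gen_eqMixin (laurent k).
HB.instance Definition _ (k : fieldType) := gen_choiceMixin (laurent k).

Section LaurentField.
Context {k : fieldType}.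
Implicit Types f g h : laurent k.

Lemma laurentP f g : (f : int -> k) =1 g -> f = g.
Proof.
case: f g => [f bf] [g bg] /= /funext E; subst g.
by congr Laurent; exact: Prop_irrelevance.
Qed.

Definition bnd (c : int -> k) (N : int) := forall n, n < N -> c n = 0.

Lemma bnd_le c M N : M <= N -> bnd c N -> bnd c M.
Proof. by move=> MN b n nM; apply: b; apply: lt_le_trans MN. Qed.

Lemma bnd2 f g : exists N, bnd f N /\ bnd g N.
Proof.
have [M bf] := lcoef_bounded f; have [N bg] := lcoef_bounded g.
exists (Num.min M N).
by split; [apply: bnd_le bf|apply: bnd_le bg]; rewrite ge_min lexx ?orbT.
Qed.

Definition lzero : laurent k :=
  Laurent (ex_intro (bnd (fun=> 0)) 0 (fun _ _ => erefl)).

Lemma lopp_subproof f : exists N, bnd (fun n => - f n) N.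
Proof.
by have [N b] := lcoef_bounded f; exists N => n /b ->; rewrite oppr0.
Qed.
Definition lopp f := Laurent (lopp_subproof f).

Lemma ladd_subproof f g : exists N, bnd (fun n => f n + g n) N.
Proof.
by have [N [bf bg]] := bnd2 f g; exists N => n lt; rewrite bf ?bg ?addr0.
Qed.
Definition ladd f g := Laurent (ladd_subproof f g).

Lemma laddA : associative ladd.
Proof. by move=> f g h; apply: laurentP => n /=; rewrite addrA. Qed.
Lemma laddC : commutative ladd.
Proof. by move=> f g; apply: laurentP => n /=; rewrite addrC. Qed.
Lemma ladd0 : left_id lzero ladd.
Proof. by move=> f; apply: laurentP => n /=; rewrite add0r. Qed.
Lemma laddN : left_inverse lzero lopp ladd.
Proof. by move=> f; apply: laurentP => n /=; rewrite addNr. Qed.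

HB.instance Definition _ :=
  GRing.isZmodule.Build (laurent k) laddA laddC ladd0 laddN.

(* The sum has finite support because f and g are bounded below. *)
Definition cauchy_prod (c d : int -> k) (n : int) : k :=
  \sum_(i \in [set: int]) c i * d (n - i).

Lemma cauchy_prod_lt c d M N n : bnd c M -> bnd d N -> n < M + N ->
  cauchy_prod c d n = 0.
Proof.
move=> bc bd lt; apply: fsbig1 => i _.
have [/bc->|le] := ltP i M; first by rewrite mul0r.
by rewrite bd ?mulr0 //; lia.
Qed.

Lemma cauchy_prod_ge c d M N (m : nat) : bnd c M -> bnd d N ->
  cauchy_prod c d (M + N + m%:Z) =
  \sum_(i < m.+1) c (M + i%:Z) * d (N + (m - i)%N%:Z).
Proof.
move=> bc bd; pose r := map (fun i : nat => M + i%:Z) (iota 0 m.+1).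
rewrite /cauchy_prod (fsbigE r) //.
- rewrite big_map -/(index_iota 0 m.+1).
  under eq_bigl do rewrite in_setT.
  rewrite big_mkord; apply: eq_bigr => i _; congr (_ * d _).
  by have := ltn_ord i; lia.
- by rewrite map_inj_uniq ?iota_uniq // => i j; lia.
move=> i _ /negP nin.
have [/bc->|le] := ltP i M; first by rewrite mul0r.
rewrite bd ?mulr0 //; rewrite ltNge; apply/negP => le2.
apply: nin; apply/mapP; exists (absz (i - M)%R); last by lia.
by rewrite mem_iota; lia.
Qed.

Lemma lmul_subproof f g : exists N, bnd (cauchy_prod f g) N.
Proof.
have [N [bf bg]] := bnd2 f g.
by exists (N + N) => n; exact: cauchy_prod_lt.
Qed.
Definition lmul f g := Laurent (lmul_subproof f g).

Lemma lmulC : commutative lmul.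
Proof.
move=> f g; apply: laurentP => n; rewrite /= /cauchy_prod.
rewrite (reindex_fsbigT (fun i : int => n - i)) /=; last first.
  by exists (fun i : int => n - i) => i; lia.
by apply: eq_fsbigr => i _; rewrite mulrC opprB addrC subrK.
Qed.

Definition ltrunc (c : int -> k) (M : int) (m : nat) : {poly k} :=
  \poly_(i < m.+1) c (M + i%:Z).

Lemma cauchy_prod_ltrunc c d M N (j m : nat) : bnd c M -> bnd d N ->
  (j <= m)%N ->
  cauchy_prod c d (M + N + j%:Z) = (ltrunc c M m * ltrunc d N m)`_j.
Proof.
move=> bc bd jm; rewrite (cauchy_prod_ge _ bc bd) coefM; apply: eq_bigr => i _.
by have ij := ltn_ord i; rewrite !coef_poly !ifT //; lia.
Qed.

Lemma coefM_congr (p q q' : {poly k}) m :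
  (forall j, (j <= m)%N -> q`_j = q'`_j) -> (p * q)`_m = (p * q')`_m.
Proof. by move=> E; rewrite !coefM; apply: eq_bigr => i _; rewrite E ?leq_subr. Qed.

Lemma lmulA : associative lmul.
Proof.
move=> f g h; apply: laurentP => n.
have [N [bf bg]] := bnd2 f g; have [P bh] := lcoef_bounded h.
have bfg : bnd (lmul f g) (N + N) by move=> i; exact: cauchy_prod_lt.
have bgh : bnd (lmul g h) (N + P) by move=> i; exact: cauchy_prod_lt.
have [lt|le] := ltP n (N + N + P).
  rewrite [RHS](cauchy_prod_lt bfg bh) //.
  by rewrite [LHS](cauchy_prod_lt bf bgh) ?addrA.
set m := absz (n - (N + N + P))%R; have -> : n = N + N + P + m%:Z by lia.
rewrite [RHS](cauchy_prod_ltrunc bfg bh (leqnn m)).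
rewrite -[N + N + P]addrA [LHS](cauchy_prod_ltrunc bf bgh (leqnn m)).
rewrite (@coefM_congr _ _ (ltrunc g N m * ltrunc h P m)); last first.
  by move=> j jm; rewrite -cauchy_prod_ltrunc // coef_poly ltnS jm.
rewrite mulrA ![_ * ltrunc h P m]mulrC; apply: coefM_congr => j jm.
by rewrite -cauchy_prod_ltrunc // coef_poly ltnS jm.
Qed.

Lemma lone_subproof : exists N, bnd (fun n => (n == 0)%:R) N.
Proof. by exists 0 => n n0; rewrite lt_eqF. Qed.
Definition lone := Laurent lone_subproof.

Lemma lmul1 : left_id lone lmul.
Proof.
move=> f; apply: laurentP => n; rewrite /= /cauchy_prod.
rewrite (fsbigE [:: 0]) //= ?big_seq1_cond ?in_setT.
  by rewrite big_cons big_nil in_setT eqxx mul1r subr0 addr0.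
by move=> i _; rewrite inE => /negPf ->; rewrite mul0r.
Qed.

Lemma lmulD : left_distributive lmul +%R.
Proof.
move=> f g h; apply: laurentP => n.
have [N [bf bg]] := bnd2 f g; have [P bh] := lcoef_bounded h.
have bfg : bnd (f + g) N by move=> i lt /=; rewrite bf ?bg ?addr0.
rewrite -[RHS]/(cauchy_prod f h n + cauchy_prod g h n).
have [lt|le] := ltP n (N + P).
  by rewrite /= !(@cauchy_prod_lt _ _ N P) ?addr0.
have -> : n = N + P + (absz (n - (N + P))%R)%:Z by lia.
rewrite /= !(@cauchy_prod_ge _ _ N P) // -big_split /=.
by apply: eq_bigr => i _; rewrite mulrDl.
Qed.

Lemma lone_neq0 : lone != 0.
Proof.
apply/eqP => /(congr1 (fun f : laurent k => f 0)) /= /eqP.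
by rewrite oner_eq0.
Qed.

HB.instance Definition _ := GRing.Zmodule_isComNzRing.Build (laurent k)
  lmulA lmulC lmul1 lmulD lone_neq0.

Fixpoint inv_seq (c : nat -> k) (n : nat) : seq k :=
  if n is m.+1 then
    rcons (inv_seq c m)
      (((m == 0%N)%:R - \sum_(i < m) (inv_seq c m)`_i * c (m - i)%N) / c 0%N)
  else [::].

Lemma size_inv_seq c n : size (inv_seq c n) = n.
Proof. by elim: n => //= n IH; rewrite size_rcons IH. Qed.

Lemma nth_inv_seq c n i : (i < n)%N -> (inv_seq c n)`_i = (inv_seq c i.+1)`_i.
Proof.
elim: n => // n IH; rewrite ltnS leq_eqVlt => /predU1P[->//|lt].
by rewrite [LHS]nth_rcons size_inv_seq lt IH.
Qed.

Lemma inv_seqP (c : nat -> k) m : c 0%N != 0 ->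
  \sum_(i < m.+1) (inv_seq c i.+1)`_i * c (m - i)%N = (m == 0%N)%:R.
Proof.
move=> c0; rewrite big_ord_recr /= subnn nth_rcons size_inv_seq ltnn eqxx.
rewrite divfK // addrC -[RHS]subr0 -[LHS]addrA; congr (_ + _).
rewrite addrC -sumrB big1 ?oppr0 // => i _.
by rewrite (nth_inv_seq _ (ltn_ord i)) subrr.
Qed.

Lemma lmulV_ex f : f != 0 -> exists g, g * f = 1.
Proof.
move=> nz; have [N bf] := lcoef_bounded f.
have ex : exists j : nat, f (N + j%:Z) != 0.
  apply: contra_neqP nz => nex; apply: laurentP => n /=.
  have [/bf//|le] := ltP n N; apply: contra_notP nex => /eqP ?.
  by exists (absz (n - N)%R); rewrite (_ : N + _ = n) //; lia.
have [j0 fj0 jmin] := ex_minnP ex.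
pose M := N + j0%:Z; pose c (i : nat) := f (M + i%:Z).
have bM : bnd f M.
  move=> n nM; have [/bf//|le] := ltP n N.
  have [//|fn] := eqVneq (f n) 0.
  have := jmin (absz (n - N)%R); rewrite (_ : N + _ = n); last by lia.
  by move=> /(_ fn); rewrite /M in nM; lia.
pose d (n : int) := if n < - M then 0 else (inv_seq c (absz (n + M)%R).+1)`_(absz (n + M)%R).
have bd : bnd d (- M) by move=> n lt; rewrite /d lt.
exists (Laurent (ex_intro _ _ bd)); apply: laurentP => n /=.
have [lt|le] := ltP n 0.
  by rewrite (cauchy_prod_lt bd bM) ?addNr ?(lt_eqF lt).
have -> : n = - M + M + (absz n)%:Z by lia.
rewrite (cauchy_prod_ge _ bd bM).
have -> : (- M + M + (absz n)%:Z == 0) = ((absz n) == 0%N) by lia.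
rewrite -(@inv_seqP c) ?/c ?addr0 //; apply: eq_bigr => i _.
rewrite /d ifF; last by lia.
by rewrite (_ : absz (- M + i%:Z + M)%R = i) //; lia.
Qed.

Definition linv f : laurent k :=
  if pselect (exists g, g * f = 1) is left e then projT1 (cid e) else 0.

Lemma lmulVf f : f != 0 -> linv f * f = 1.
Proof. by rewrite /linv => /lmulV_ex; case: pselect => // e _; case: cid. Qed.

Lemma linv0 : linv 0 = 0.
Proof.
rewrite /linv; case: pselect => // e; exfalso; case: e => g.
by move/eqP; rewrite mulr0 eq_sym oner_eq0.
Qed.

HB.instance Definition _ :=
  GRing.ComNzRing_isField.Build (laurent k) lmulVf linv0.

(* The t-adic valuation, with value +oo at 0. *)
Definition t_adic f : \bar int :=
  infimum +oo%E [set n%:E | n in [set n : int | f n != 0]].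

End LaurentField.

(* Additive valuations with values in Z, extended by +oo at 0. *)
Record valuation (D : nzRingType) := Valuation {
  valuation_fun :> D -> \bar int;
  valuation_gtNy : forall x, (-oo < valuation_fun x)%E;
  valuation_eqy : forall x, valuation_fun x = +oo%E <-> x = 0;
  valuationM : forall x y, valuation_fun (x * y) = (valuation_fun x + valuation_fun y)%E;
  valuationD : forall x y,
    (Order.min (valuation_fun x) (valuation_fun y) <= valuation_fun (x + y)%R)%E }.

Section ResidueRing.
Context {D : nzRingType} (w : valuation D).

Lemma valuation0 : w 0 = +oo%E. Proof. exact/valuation_eqy. Qed.

Lemma valuation1 : w 1 = 0%E.
Proof.
have := valuationM w 1 1; have := valuation_gtNy w 1; rewrite mulr1.
case E: (w 1) => [r| |] // _.
  by move=> [?]; congr (_%:E); lia.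
by move/valuation_eqy: E => /eqP; rewrite oner_eq0.
Qed.

Lemma valuationN x : w (- x) = w x.
Proof.
suff N1 : w (- 1) = 0%E by rewrite -mulN1r valuationM N1 add0e.
have := valuationM w (- 1) (- 1); have := valuation_gtNy w (- 1).
rewrite mulrNN mulr1 valuation1; case E: (w (- 1)) => [r| |] // _.
by move=> [?]; congr (_%:E); lia.
Qed.

Lemma valuationB x y : (Order.min (w x) (w y) <= w (x - y)%R)%E.
Proof. by rewrite -[w y]valuationN; exact: valuationD. Qed.

Definition valring_pred : {pred D} := fun x => (0 <= w x)%E.

Record valring := ValRing { valring_val :> D; _ : valring_val \in valring_pred }.

HB.instance Definition _ := [isSub for valring_val].
HB.instance Definition _ := [Choice of valring by <:].

Lemma valring_closed : subring_closed valring_pred.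
Proof.
split=> [|x y|x y]; rewrite !unfold_in.
- by rewrite valuation1.
- by move=> x0 y0; apply: le_trans (valuationB x y); rewrite le_min x0.
- by move=> x0 y0; rewrite valuationM adde_ge0.
Qed.

HB.instance Definition _ :=
  GRing.SubChoice_isSubNzRing.Build D valring_pred valring valring_closed.

Definition maxideal : {pred valring} := fun x => (0 < w (val x))%E.

Lemma maxideal_zmod_closed : zmod_closed maxideal.
Proof.
split=> [|x y]; rewrite !unfold_in; first by rewrite raddf0 valuation0 ltry.
by move=> x0 y0; rewrite raddfB; apply: lt_le_trans (valuationB _ _); rewrite lt_min x0.
Qed.

HB.instance Definition _ :=
  GRing.isZmodClosed.Build valring maxideal maxideal_zmod_closed.

Definition residue := Quotient.quot maxideal.
HB.instance Definition _ := GRing.Zmodule.on residue.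
HB.instance Definition _ :=
  EqQuotient.copy residue (Quotient.quot maxideal).

Definition residue_one : residue := \pi_residue 1%R.
Definition residue_mul (x y : residue) : residue := \pi_residue (repr x * repr y)%R.

Lemma residue_eqP (x y : valring) :
  reflect (\pi_residue x = \pi_residue y) (0 < w (val x - val y)%R)%E.
Proof.
by rewrite -raddfB /=; apply: (iffP idP) => [H|/eqP]; [apply/eqP|];
  rewrite -Quotient.idealrBE.
Qed.

Lemma pi_residue_mul (x y : valring) :
  \pi_residue (x * y) = residue_mul (\pi_residue x) (\pi_residue y).
Proof.
apply/residue_eqP.
set x' := repr _; set y' := repr _.
have Ex : (0 < w (val x - val x')%R)%E by apply/residue_eqP; rewrite reprK.
have Ey : (0 < w (val y - val y')%R)%E by apply/residue_eqP; rewrite reprK.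
rewrite !rmorphM /= -[X in w X](subrKA (val x' * val y)) -mulrBl -mulrBr.
apply: lt_le_trans (valuationD _ _ _); rewrite lt_min !valuationM.
have vx' : (0 <= w (val x'))%E := valP x'; have vy : (0 <= w (val y))%E := valP y.
by rewrite lte_paddr ?lte_paddl.
Qed.

Lemma residue_surj (x : residue) : exists a : valring, \pi_residue a = x.
Proof. by exists (repr x); exact: reprK. Qed.

Lemma residue_mulA : associative residue_mul.
Proof.
move=> x y z; case: (residue_surj x) (residue_surj y) (residue_surj z).
move=> a <- [b <-] [c <-].
rewrite -(pi_residue_mul b c) -(pi_residue_mul a b).
by rewrite -(pi_residue_mul a (b * c)) -(pi_residue_mul (a * b) c) mulrA.
Qed.

Lemma residue_mul1 : left_id residue_one residue_mul.
Proof. by move=> x; have [a <-] := residue_surj x; rewrite -(pi_residue_mul 1 a) mul1r. Qed.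

Lemma residue_mulr1 : right_id residue_one residue_mul.
Proof. by move=> x; have [a <-] := residue_surj x; rewrite -(pi_residue_mul a 1) mulr1. Qed.

Lemma pi_residueD (x y : valring) :
  \pi_residue (x + y) = \pi_residue x + \pi_residue y.
Proof. exact: Quotient.pi_add. Qed.

Lemma residue_mulDl : left_distributive residue_mul +%R.
Proof.
move=> x y z; case: (residue_surj x) (residue_surj y) (residue_surj z).
move=> a <- [b <-] [c <-].
rewrite -(pi_residueD a b) -(pi_residue_mul a c) -(pi_residue_mul b c).
by rewrite -(pi_residue_mul (a + b) c) -pi_residueD mulrDl.
Qed.

Lemma residue_mulDr : right_distributive residue_mul +%R.
Proof.
move=> x y z; case: (residue_surj x) (residue_surj y) (residue_surj z).
move=> a <- [b <-] [c <-].
rewrite -(pi_residueD b c) -(pi_residue_mul a b) -(pi_residue_mul a c).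
by rewrite -(pi_residue_mul a (b + c)) -pi_residueD mulrDr.
Qed.

Lemma residue_one_neq0 : residue_one != 0.
Proof.
have zeroE : \pi_residue 0 = 0.
  by apply: (addrI (\pi_residue 0)); rewrite -pi_residueD !addr0.
apply/eqP; rewrite -zeroE => /residue_eqP.
by rewrite rmorph1 rmorph0 subr0 valuation1 ltxx.
Qed.

HB.instance Definition _ := GRing.Zmodule_isNzRing.Build residue
  residue_mulA residue_mul1 residue_mulr1 residue_mulDl residue_mulDr
  residue_one_neq0.

Definition residue_unit : {pred residue} :=
  fun x => `[< exists y, y * x = 1 /\ x * y = 1 >].
Definition residue_inv (x : residue) : residue :=
  if pselect (exists y, y * x = 1 /\ x * y = 1) is left e
  then projT1 (cid e) else x.

Lemma residue_mulVr : {in residue_unit, left_inverse 1 residue_inv *%R}.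
Proof.
move=> x /asboolP ex; rewrite /residue_inv; case: pselect => // e.
by case: cid => y [].
Qed.

Lemma residue_divrr : {in residue_unit, right_inverse 1 residue_inv *%R}.
Proof.
move=> x /asboolP ex; rewrite /residue_inv; case: pselect => // e.
by case: cid => y [].
Qed.

Lemma residue_unitP x y : y * x = 1 /\ x * y = 1 -> residue_unit x.
Proof. by move=> xy; apply/asboolP; exists y. Qed.

Lemma residue_inv_out : {in [predC residue_unit], residue_inv =1 id}.
Proof.
by move=> x /asboolPn nex; rewrite /residue_inv; case: pselect.
Qed.

HB.instance Definition _ := GRing.NzRing_hasMulInverse.Build residue
  residue_mulVr residue_divrr residue_unitP residue_inv_out.

Definition res (x : valring) : residue := \pi_residue x.

Lemma res_zmod_morphism : zmod_morphism res.
Proof.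
move=> x y; rewrite /res pi_residueD; congr (_ + _).
exact: Quotient.pi_opp.
Qed.

Lemma res_monoid_morphism : monoid_morphism res.
Proof. by split=> // x y; exact: pi_residue_mul. Qed.

HB.instance Definition _ :=
  GRing.isZmodMorphism.Build valring residue res res_zmod_morphism.
HB.instance Definition _ :=
  GRing.isMonoidMorphism.Build valring residue res res_monoid_morphism.

End ResidueRing.

Definition center (R : nzRingType) : set R :=
  [set x | forall y, x * y = y * x].
Arguments center : clear implicits.

Section LocalHeights.
Context {k : fieldType} {D : falgType (laurent k)} (w : valuation D).

(* D has dimension (index)^2 over its centre k((t)). *)
Definition p_power_index (p : nat) :=
  exists m : nat, \dim {:D} = ((p ^ m) ^ 2)%N.

(* e is the ramification index: with value group Z, the valuation w restricts
   to e times the t-adic one. *)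
Definition extends_t_adic :=
  exists e : nat, (0 < e)%N /\
    forall c : laurent k, w c%:A = (e%:Z%:E * t_adic c)%E.

Definition normalized := forall n : int, exists x : D, w x = n%:E.

(* The image of the residue field of k((t)) in the residue ring of D. *)
Definition base_residue : set (residue w) :=
  [set res x | x in [set x : valring w | exists c : laurent k, val x = c%:A]].

Definition purely_inseparable_residue (p : nat) :=
  forall x : residue w, exists n : nat, base_residue (x ^+ (p ^ n)).

(* The residue ring is the only sub-division-ring containing the residue field
   of k((t)) and a. *)
Definition residue_generated_by (a : residue w) :=
  forall S : {pred residue w}, GRing.divring_closed S ->
    (forall c, base_residue c -> c \in S) -> a \in S -> forall x, x \in S.

Implicit Types (u : {rmorphism residue w -> valring w}) (z x : D).
Implicit Type (b : residue w).

Definition embedding u := cancel u (@res D w).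

Definition parameter z := w z = 1%E.

Definition converges_to (s : nat -> D) x :=
  forall C : int, exists N : nat, forall n, (N <= n)%N ->
    (C%:E <= w (s n - x)%R)%E.

(* The coefficients (c_j) in x = sum_(j >= 0) u(c_j) z^j, for x in the
   valuation ring; they exist and are unique when u is an embedding and z a
   parameter. *)
Definition expansion u z x : nat -> residue w :=
  xget (fun=> 0)
    [set c : nat -> residue w | converges_to (fun n =>
      \sum_(j < n) val (u (c j)) * z ^+ j) x].

(* _m delta_i (b) for i >= 1; for i = 0 this is alpha^m (b). *)
Definition delta u z (m : int) (i : nat) b : residue w :=
  expansion u z (z ^ m * val (u b) * z ^ (- m)) i.

(* i(u, b), which does not depend on the parameter z when b is central and
   fixed by alpha. *)
Definition height_at u z b : \bar int :=
  w (z * val (u b) * z^-1 - val (u b)).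

(* Minima and maxima of values are the greatest lower and least upper bounds
   in \bar int, which always exist; a nonempty set of integers bounded on the
   relevant side attains its bound, and the supremum of a set unbounded above
   is +oo. *)
Definition local_height u z : \bar int :=
  infimum +oo%E [set height_at u z b | b in [set: residue w]].

Definition appropriate u z :=
  parameter z /\
  exists i : nat, [/\ (0 < i)%N, local_height u z = i%:Z%:E &
    exists2 b, center (residue w) b & delta u z 1 i b != 0].

Definition semilocal_height u : \bar int :=
  supremum -oo%E [set local_height u z | z in parameter].

Definition d_value u z (i : nat) (a : residue w) : \bar int :=
  w (z ^ (- i%:Z) * val (u a) * z ^+ i - val (u a)
     - val (u (delta u z (- i%:Z) i a)) * z ^+ i).

(* The expression d_value has no meaning unless i(u, a) = i is finite. *)
Definition d_D (a : residue w) : \bar int :=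
  supremum -oo%E
    [set v | exists u z (i : nat), [/\ embedding u, appropriate u z,
       height_at u z a = i%:Z%:E & v = d_value u z i a]].

End LocalHeights.

Arguments p_power_index {k} D p.

(* Main.v *)
(* The derivation b |-> delta_i(b), i = i(u,z), vanishes on the residue field
   of F: an element c of it lifts to a central C, and conjugation by z moves
   u(c) - C, which lies in the maximal ideal, only by terms of value > i. As a
   generates the residue ring, delta_i(a) <> 0, so i(u,a) = i(u,z) for every z.
   For z with i(u,z) = i(u) the first correction term of z^-i u(a) z^i is thus
   the one in degree i(u), and removing it leaves an element of larger value. *)
Require Import Defs.
From HB Require Import structures.
From mathcomp Require Import all_boot all_order all_algebra all_field.
From mathcomp Require Import boolp classical_sets constructive_ereal.
From mathcomp Require Import zify.

Set Implicit Arguments.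
Unset Strict Implicit.
Unset Printing Implicit Defensive.

Import Order.TTheory GRing.Theory Num.Theory.

Local Open Scope ring_scope.

(** * Suprema and infima in the integers extended by both infinities *)

Section ExtendedIntegers.
Local Open Scope classical_set_scope.
Local Open Scope ereal_scope.
Implicit Types (A : set (\bar int)) (x : \bar int) (n : int).

Lemma lte_int_succ n x : (n%:E < x) = ((n + 1)%:E <= x).
Proof. by case: x => [r| |] //=; rewrite ?lte_fin ?lee_fin ?ltey ?leey //; lia. Qed.

Lemma lte_int_pred n x : (x < n%:E) = (x <= (n - 1)%:E).
Proof. by case: x => [r| |] //=; rewrite ?lte_fin ?lee_fin ?ltNyr ?leNye //; lia. Qed.

(** Integers are discrete: if the bound [n] were not attained, [n - 1] would already bound [A]. *)
Lemma supremum_fin_mem A n : supremum -oo A = n%:E -> A n%:E.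
Proof.
rewrite /supremum; case: ifP => // _; case: xgetP => // y -> [ubA lbA] yE.
apply: contrapT => nA; suff /lbA : ubound A (n - 1)%:E.
  by rewrite yE lee_fin; lia.
move=> x Ax; rewrite -lte_int_pred lt_neqAle -{2}yE ubA // andbT.
by apply/eqP => xE; apply: nA; rewrite -xE.
Qed.

Lemma infimum_fin_mem A n : infimum +oo A = n%:E ->
  A n%:E /\ lbound A n%:E.
Proof.
rewrite /infimum; case: ifP => // _; case: xgetP => // y -> [lbA ubA] yE.
split; last by rewrite -yE.
apply: contrapT => nA; suff /ubA : lbound A (n + 1)%:E.
  by rewrite yE lee_fin; lia.
move=> x Ax; rewrite -lte_int_succ lt_neqAle -{2}yE lbA // andbT.
by apply/eqP => xE; apply: nA; rewrite xE.
Qed.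

(** If no integer bounds [A], the supremum is [+oo]. If one does but [A] has no integer member,
    every member is [-oo]. Otherwise the member closest to the bound is a maximum. Existence ensures
    that [supremum] does not fall back on its default value. *)
Lemma supremums_bar_int A : A !=set0 -> supremums A !=set0.
Proof.
move=> [x0 Ax0].
have [[N ubN]|nub] := pselect (exists N, ubound A N%:E); last first.
  exists +oo; split=> [x _|y uby]; first exact: leey.
  case: y uby => [r| |] uby; rewrite ?leey //.
    by case: nub; exists r.
  case: nub; exists 0%R => x /uby; rewrite leeNy_eq => /eqP->.
  exact: leNye.
have [[n0 An0]|nfin] := pselect (exists n, A n%:E); last first.
  exists x0; split=> [x Ax|y]; last exact.
  have onlyNy y : A y -> y = -oo.
    by case: y => [r| |] // Ay; [case: nfin; exists r|have := ubN _ Ay].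
  by rewrite (onlyNy _ Ax) leNye.
(* Members are indexed by their distance [j] below the bound [N], so the least such [j] yields the
   maximum. *)
have ex : exists j : nat, `[< A (N - j%:Z)%:E >].
  have := ubN _ An0; rewrite lee_fin => le.
  exists (absz (N - n0)%R); apply/asboolP.
  by rewrite (_ : (N - _)%R = n0) //; lia.
have [j /asboolP Aj jmin] := ex_minnP ex.
exists (N - j%:Z)%:E; split=> [x Ax|y]; last exact.
case: x Ax => [r| |] Ax; rewrite ?leNye //; last by have := ubN _ Ax.
have := ubN _ Ax; rewrite !lee_fin => le.
have : (j <= absz (N - r)%R)%N.
  by apply: jmin; apply/asboolP; rewrite (_ : (N - `|(N - r)%R|%N%:Z)%R = r) //; lia.
by lia.
Qed.

Lemma supremum_bar_int_ub A x : A x -> x <= supremum -oo A.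
Proof.
move=> Ax; have ne : A !=set0 by exists x.
rewrite /supremum; case: ifP => [/eqP A0|_]; first by rewrite A0 in Ax.
case: xgetP => [y _ [ubA _]|nex]; first exact: ubA.
by case: (supremums_bar_int ne) => y /nex.
Qed.

End ExtendedIntegers.

(** * Lower bounds for values, and approximation of an element by its residue *)

Section Valuation.
Context {D : nzRingType} (w : valuation D).
Local Open Scope ereal_scope.
Implicit Types (x y : D) (m n : int).

Lemma valuation_geD n x y : n%:E <= w x -> n%:E <= w y -> n%:E <= w (x + y)%R.
Proof. by move=> nx ny; apply: le_trans (valuationD w x y); rewrite le_min nx. Qed.

Lemma valuation_geB n x y : n%:E <= w x -> n%:E <= w y -> n%:E <= w (x - y)%R.
Proof. by move=> nx ny; apply: valuation_geD; rewrite ?valuationN. Qed.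

Lemma valuation_distC x y : w (x - y)%R = w (y - x)%R.
Proof. by rewrite -valuationN opprB. Qed.

Lemma valuation_geM m n x y :
  m%:E <= w x -> n%:E <= w y -> (m + n)%:E <= w (x * y)%R.
Proof. by move=> mx ny; rewrite valuationM EFinD leeD. Qed.

Lemma valring_ge0 (X : valring w) : 0%:E <= w (val X).
Proof. exact: (valP X). Qed.

Lemma valuation_ge_sum n (I : Type) (r : seq I) (P : pred I) (F : I -> D) :
  (forall i, P i -> n%:E <= w (F i)) -> n%:E <= w (\sum_(i <- r | P i) F i)%R.
Proof.
move=> nF; apply: (big_ind (fun x => n%:E <= w x)) => //.
  by rewrite valuation0 leey.
by move=> x y; exact: valuation_geD.
Qed.

Lemma valring_approx (u : {rmorphism residue w -> valring w}) (X : valring w) :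
  cancel u (@res D w) -> 1%:E <= w (val X - val (u (res X)))%R.
Proof.
move=> uK; rewrite -(add0r 1%R) -lte_int_succ.
by apply/residue_eqP; exact: (esym (uK (res X))).
Qed.

Lemma embedding_ge1_eq0 (u : {rmorphism residue w -> valring w}) b :
  cancel u (@res D w) -> 1%:E <= w (val (u b)) -> b = 0%R.
Proof.
move=> uK; rewrite -(add0r 1%R) -lte_int_succ => lt.
rewrite -(uK b) -(raddf0 (@res D w)); apply/residue_eqP.
by rewrite /= subr0.
Qed.

End Valuation.

(** * Power series expansions in a parameter *)

Section ParameterExpansion.
Context {k : fieldType} {D : falgType (laurent k)} (w : valuation D).
Context (D_division : forall x : D, x != 0 -> x \is a GRing.unit).
Context (u : {rmorphism residue w -> valring w}) (uK : embedding u).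
Context (z : D) (z_param : parameter w z).
Implicit Types (x y : D) (b : residue w) (n : int) (X : valring w).

Lemma parameter_unit : z \is a GRing.unit.
Proof.
apply: D_division; apply/eqP => z0.
by move: z_param; rewrite /parameter z0 valuation0.
Qed.
Let zU := parameter_unit.

Lemma valuation_parameterV : w z^-1 = (- 1)%:E.
Proof.
have := valuationM w z z^-1; rewrite divrr // valuation1 z_param.
by case: (w z^-1) => [r| |] // [?]; congr (_%:E); lia.
Qed.

Lemma valuation_parameterX (n : nat) : w (z ^+ n)%R = n%:Z%:E.
Proof.
elim: n => [|n IH]; first by rewrite expr0 valuation1.
by rewrite exprS valuationM IH z_param -EFinD; congr (_%:E); lia.
Qed.

Lemma valuation_conj x : w (z * x * z^-1)%R = w x.
Proof.
rewrite !valuationM z_param valuation_parameterV.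
by case: (w x) => [r| |] //; rewrite -!EFinD; congr (_%:E); lia.
Qed.

Lemma valuation_conjV x : w (z^-1 * x * z)%R = w x.
Proof. by rewrite -valuation_conj !mulrA mulrV // mul1r mulrK. Qed.

Lemma valuation_ge_mulz n x : ((n + 1)%:E <= w (x * z)%R)%E = (n%:E <= w x)%E.
Proof.
rewrite valuationM z_param; case: (w x) => [r| |]; last 2 first.
- by rewrite !leey.
- by rewrite !leeNy_eq.
by rewrite -EFinD !lee_fin lerD2r.
Qed.

(** One step of the expansion: [X] and the lift of its residue differ by an element of the maximal
    ideal, which is a right multiple of [z]. *)
Lemma valring_step_ex X :
  exists Y : valring w, val X = val (u (res X)) + val Y * z.
Proof.
pose y := (val X - val (u (res X))) / z.
have yV : y \in valring_pred w.
  rewrite unfold_in -[0%E]/(0%:E)%E -valuation_ge_mulz divrK //.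
  by rewrite add0r valring_approx.
by exists (ValRing yV); rewrite /= divrK // addrC subrK.
Qed.

Lemma approximants_ex X : exists c : nat -> residue w, forall n : nat,
  (n%:Z%:E <= w (val X - \sum_(j < n) val (u (c j)) * z ^+ j)%R)%E.
Proof.
have [next nextE] := choice valring_step_ex.
(* The coefficients are the residues of the successive quotients by [z]. *)
exists (fun j => res (iter j next X)) => n.
elim: n X => [|n IH] X; first by rewrite big_ord0 subr0 valring_ge0.
rewrite big_ord_recl expr0 mulr1 {1}(nextE X) /= opprD addrACA subrr add0r.
rewrite (_ : \sum_(j < n) _ =
  (\sum_(j < n) val (u (res (iter j next (next X)))) * z ^+ j) * z); last first.
  by rewrite mulr_suml; apply: eq_bigr => j _; rewrite -iterSr exprSr mulrA.
by rewrite -mulrBl -addn1 PoszD valuation_ge_mulz; exact: IH.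
Qed.

Lemma expansion_approx X (n : nat) :
  (n%:Z%:E <=
   w (val X - \sum_(j < n) val (u (expansion u z (val X) j)) * z ^+ j)%R)%E.
Proof.
(* The default of [xget] is excluded: the successive residues give a convergent series. *)
rewrite /expansion; case: xgetP => [c _ cvg|nex]; last first.
  have [c cX] := approximants_ex X; case: (nex c) => C.
  exists (absz C) => m le; rewrite valuation_distC.
  by apply: le_trans (cX m); rewrite lee_fin; lia.
(* Convergence controls only late partial sums. One of length [n + N] is cut at [n]; the dropped
   terms have value at least [n]. *)
have [N /(_ (n + N)%N (leq_addl _ _))] := cvg n.
rewrite big_split_ord /=; set tail := (X in (_ + X - _)%R).
have tail_ge : (n%:Z%:E <= w tail)%E.
  rewrite /tail; apply: valuation_ge_sum => j _; rewrite -[n%:Z]add0r.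
  apply: valuation_geM; first exact: valring_ge0.
  by rewrite valuation_parameterX lee_fin; lia.
rewrite valuation_distC => /valuation_geB /(_ tail_ge).
by rewrite addrAC addrK.
Qed.

(** Uniqueness of coefficients: the constant term lies in the maximal ideal, since the other terms
    are multiples of [z], and so it vanishes. Cancelling one [z] leaves a shorter sum. *)
Lemma expansion_coef_eq0 (c : nat -> residue w) (n : nat) :
  (n%:Z%:E <= w (\sum_(j < n) val (u (c j)) * z ^+ j)%R)%E ->
  forall j, (j < n)%N -> c j = 0.
Proof.
elim: n c => // n IH c; rewrite big_ord_recl expr0 mulr1.
rewrite (_ : \sum_(j < n) _ =
  (\sum_(j < n) val (u (c j.+1)) * z ^+ j) * z); last first.
  by rewrite mulr_suml; apply: eq_bigr => j _; rewrite exprSr mulrA.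
set s := \sum_(_ < _) _ => ge.
have s_ge0 : (0%:E <= w s)%E.
  rewrite /s; apply: valuation_ge_sum => j _; rewrite -[0]addr0.
  apply: valuation_geM; first exact: valring_ge0.
  by rewrite valuation_parameterX lee_fin.
have c0 : c 0%N = 0.
  apply: (embedding_ge1_eq0 uK); rewrite -[val _](addrK (s * z)).
  apply: valuation_geB; last by rewrite -(add0r 1) valuation_ge_mulz.
  by apply: le_trans ge; rewrite lee_fin; lia.
move: ge; rewrite c0 !raddf0 add0r -addn1 PoszD valuation_ge_mulz.
move=> /(IH (fun j => c j.+1)) cS; case=> [_|j jn]; first exact: c0.
by apply: cS; rewrite addn1 in jn.
Qed.

(** By uniqueness the coefficients below degree [n] are [b, 0, ..., 0], so the coefficient of degree
    [n] gives the first correction to [u b]. *)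
Lemma expansion_leading X b (n : nat) : (0 < n)%N ->
  (n%:Z%:E <= w (val X - val (u b))%R)%E ->
  (n.+1%:Z%:E <=
   w (val X - val (u b) - val (u (expansion u z (val X) n)) * z ^+ n)%R)%E.
Proof.
case: n => // n _ ge; set e := expansion u z (val X).
(* As [n] has become [n.+1], index 0 is always in range and [b] can be absorbed into the constant
   coefficient. *)
pose c j := e j - (if j is 0%N then b else 0).
have sumc : \sum_(j < n.+1) val (u (c j)) * z ^+ j =
    \sum_(j < n.+1) val (u (e j)) * z ^+ j - val (u b).
  rewrite !big_ord_recl !expr0 !mulr1 /c /= !raddfB addrAC; congr (_ + _ - _).
  by apply: eq_bigr => j _; rewrite subr0.
have c_eq0 : forall j, (j < n.+1)%N -> c j = 0.
  apply: expansion_coef_eq0; rewrite sumc.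
  rewrite -[X in w X](subrKA (val X)) valuation_geD //.
  by rewrite valuation_distC expansion_approx.
have := expansion_approx X n.+2; rewrite big_ord_recr /= -/e opprD addrA.
suff -> : \sum_(j < n.+1) val (u (e j)) * z ^+ j = val (u b) by [].
apply/eqP; rewrite -subr_eq0 -sumc big1 // => j _.
by rewrite c_eq0 // !raddf0 mul0r.
Qed.

(** * Conjugation by powers of the parameter *)

Lemma conj_shift_ge (n : nat) : (forall b, (n%:Z%:E <= height_at u z b)%E) ->
  forall X, (n%:Z%:E <= w (z * val X * z^-1 - val X)%R)%E.
Proof.
(* Write [X] as a lifted residue plus [Y * z]. The shift of [Y * z] is that of [Y] times [z], which
   gains one unit of value at each step; the lifted residue limits the induction to [m <= n]. *)
move=> ge; suff below (m : nat) : (m <= n)%N -> forall X,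
    (m%:Z%:E <= w (z * val X * z^-1 - val X)%R)%E by exact: below.
elim: m => [_|m IH mn] X.
  by apply: valuation_geB; rewrite ?valuation_conj; exact: valring_ge0.
have [Y ->] := valring_step_ex X.
rewrite mulrDr mulrDl opprD addrACA; apply: valuation_geD.
  by apply: le_trans (ge _); rewrite lee_fin.
rewrite (_ : _ - _ = (z * val Y * z^-1 - val Y) * z); last first.
  by rewrite mulrBl divrK // !mulrA mulrK.
by rewrite -addn1 PoszD valuation_ge_mulz IH // ltnW.
Qed.

Lemma conjX_shift_ge n x : (n%:E <= w (z * x * z^-1 - x)%R)%E ->
  forall m : nat, (n%:E <= w (z ^- m * x * z ^+ m - x)%R)%E.
Proof.
move=> ge; elim=> [|m IH].
  by rewrite expr0 invr1 mul1r mulr1 subrr valuation0 leey.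
(* Passing from [m] to [m + 1] conjugates the previous difference and adds [z^-1 * x * z - x],
   itself minus a conjugate of the shift of [x]; conjugation preserves values. *)
rewrite (_ : _ - x = z^-1 * (z ^- m * x * z ^+ m - x) * z
                     - z^-1 * (z * x * z^-1 - x) * z).
  by apply: valuation_geB; rewrite valuation_conjV.
rewrite -mulrBl -mulrBr opprB addrA subrK mulrBr mulrBl !mulrA mulVr // mul1r.
by rewrite divrK // exprSr invrM ?unitrX // !mulrA.
Qed.

(** * The leading derivation of conjugation by the parameter, and the value of its correction
    term *)

Section LeadingDerivation.
Context (i : nat) (height_ge : forall b, (i%:Z%:E <= height_at u z b)%E).

Let shift x := z * x * z^-1 - x.

(** The kernel of the leading derivation, expressed through values so that closure properties follow
    from identities in [D]. *)
Let killed : {pred residue w} :=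
  fun b => `[< (i.+1%:Z%:E <= w (shift (val (u b))))%E >].

(** Twisted Leibniz rule; the twist, conjugation by [z], preserves values. *)
Let shiftM x y : shift (x * y) = z * x * z^-1 * shift y + shift x * y.
Proof.
rewrite /shift mulrBr mulrBl addrA; congr (_ - _).
by rewrite !mulrA divrK // subrK.
Qed.

Let killedM b c : b \in killed -> c \in killed -> b * c \in killed.
Proof.
move=> /asboolP kb /asboolP kc; apply/asboolP; rewrite rmorphM rmorphM shiftM.
apply: valuation_geD.
  rewrite -[i.+1%:Z]add0r; apply: valuation_geM => //.
  by rewrite valuation_conj; exact: valring_ge0.
by rewrite -[i.+1%:Z]addr0; apply: valuation_geM => //; exact: valring_ge0.
Qed.

Let killedV b : b \in killed -> b^-1 \in killed.
Proof.
(* By convention the inverse of a non-unit is the element itself. *)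
move=> kb; have [bU|nbU] := boolP (b \is a GRing.unit); last by rewrite invr_out.
move/asboolP: kb => kb; apply/asboolP.
have bV : val (u b) * val (u b^-1) = 1.
  by rewrite -!rmorphM divrr // !rmorph1.
have Vb : val (u b^-1) * val (u b) = 1.
  by rewrite -!rmorphM mulVr // !rmorph1.
have shift1 : shift 1 = 0 by rewrite /shift mulr1 divrr // subrr.
(* Obtained by applying the Leibniz rule to [b^-1 * b = 1] and solving. *)
have -> : shift (val (u b^-1)) =
    - (z * val (u b^-1) * z^-1 * shift (val (u b)) * val (u b^-1)).
  apply/eqP; rewrite -addr_eq0 addrC; have := shiftM (val (u b^-1)) (val (u b)).
  rewrite Vb shift1 => /(congr1 (fun x => x * val (u b^-1))).
  by rewrite mul0r mulrDl -[shift _ * _ * _]mulrA bV mulr1 => <-.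
rewrite valuationN -[i.+1%:Z]addr0; apply: valuation_geM; last exact: valring_ge0.
rewrite -[i.+1%:Z]add0r.
apply: valuation_geM => //.
by rewrite valuation_conj; exact: valring_ge0.
Qed.

Lemma killed_divring_closed : GRing.divring_closed killed.
Proof.
split=> [|b c /asboolP kb /asboolP kc|b c kb kc]; last exact/killedM/killedV.
  apply/asboolP; rewrite !rmorph1 /shift mulr1 divrr // subrr.
  by rewrite valuation0 leey.
apply/asboolP; rewrite !raddfB /shift.
rewrite (_ : _ - _ = shift (val (u b)) - shift (val (u c))); last first.
  by rewrite /shift mulrBr mulrBl !opprD !opprK addrACA.
exact: valuation_geB.
Qed.

(** The lift [u c] need not be central, but it differs from a central element by some [Y * z]. Only
    this error is moved, and the factor [z] raises the bound from [i] to [i + 1]. *)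
Lemma killed_base_residue c : base_residue c -> c \in killed.
Proof.
move=> [X [f Xf] <-]; apply/asboolP.
have [Y uXE] : exists Y : valring w, val (u (res X)) = val X + val Y * z.
  have := valring_approx X uK; rewrite -[1]add0r => ge.
  have yV : (val (u (res X)) - val X) / z \in valring_pred w.
    by rewrite unfold_in -[0%E]/(0%:E)%E -valuation_ge_mulz divrK // valuation_distC.
  by exists (ValRing yV); rewrite /= divrK // addrC subrK.
rewrite uXE (_ : shift _ = shift (val Y) * z); last first.
  rewrite /shift Xf mulrDr mulrDl opprD addrACA -scalerAr mulr1 -scalerAl.
  by rewrite divrr // subrr add0r mulrBl divrK // !mulrA mulrK.
by rewrite -addn1 PoszD valuation_ge_mulz; exact: conj_shift_ge.
Qed.

Lemma height_at_generator a : residue_generated_by a ->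
  (exists b, height_at u z b = i%:Z%:E) -> height_at u z a = i%:Z%:E.
Proof.
move=> gen [b hb]; apply/eqP; rewrite eq_le height_ge andbT leNgt.
rewrite lte_int_succ -PoszD addn1; apply/negP => ka.
have /asboolP : b \in killed.
  by apply: gen killed_divring_closed killed_base_residue _ _; exact/asboolP.
by rewrite -[w _]/(height_at u z b) hb lee_fin; lia.
Qed.

(** Were this coefficient zero, [expansion_leading] would push the value of the shift of [u b]
    beyond [i]. *)
Lemma delta_neq0 b : (0 < i)%N -> height_at u z b = i%:Z%:E ->
  delta u z 1 i b != 0.
Proof.
move=> i0 hb; apply/eqP => d0.
have XV : z * val (u b) * z^-1 \in valring_pred w.
  by rewrite unfold_in valuation_conj; exact: valring_ge0.
have := @expansion_leading (ValRing XV) b i i0.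
rewrite /= -[w (_ - _)%R]/(height_at u z b) hb lexx => /(_ isT).
rewrite -[expansion _ _ _ _]/(delta u z 1 i b) d0 !raddf0 mul0r subr0.
by rewrite -[w _]/(height_at u z b) hb lee_fin; lia.
Qed.

Lemma d_value_gt a : (0 < i)%N -> (i%:Z%:E < d_value u z i a)%E.
Proof.
(* In [delta] with exponent [- i] the right factor is [z ^ (- - i)], so both conjugations agree and
   [expansion_leading] applies. *)
move=> i0; rewrite lte_int_succ -PoszD addn1 /d_value /delta opprK -!exprnN.
rewrite -exprnP.
have shift_ge := conjX_shift_ge (height_ge a) i.
have XV : z ^- i * val (u a) * z ^+ i \in valring_pred w.
  rewrite unfold_in -[X in w X](subrK (val (u a))) -[0%E]/(0%:E)%E.
  apply: valuation_geD; last exact: valring_ge0.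
  by apply: le_trans shift_ge; rewrite lee_fin.
exact: (@expansion_leading (ValRing XV)).
Qed.

End LeadingDerivation.

End ParameterExpansion.

Theorem theorem4 (p : nat) (k : fieldType) (D : falgType (laurent k))
    (w : valuation D) (a : residue w)
    (u : {rmorphism residue w -> valring w}) (i : nat)
    (char_k : p \in [pchar k]) (p_gt2 : (2 < p)%N)
    (D_division : forall x : D, x != 0 -> x \is a GRing.unit)
    (D_center : 'Z({:D})%VS = 1%VS)
    (D_p_algebra : p_power_index D p)
    (w_t_adic : extends_t_adic w) (w_normalized : normalized w)
    (residue_center : center (residue w) = [set: residue w]%classic)
    (residue_insep : purely_inseparable_residue w p)
    (residue_simple : residue_generated_by a)
    (u_embedding : embedding u)
    (i_semilocal : semilocal_height u = i%:Z%:E)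
    (p_ndvd_i : ~~ (p %| i)%N) :
  (semilocal_height u < d_D a)%E.
Proof.
(* Since [p] divides 0, the non-divisibility gives [i > 0]. *)
have i0 : (0 < i)%N by case: i p_ndvd_i {i_semilocal} => //; rewrite dvdn0.
have [z z_param local_i] := supremum_fin_mem i_semilocal.
have [[b _ hb] lb] := infimum_fin_mem local_i.
have height_ge c : (i%:Z%:E <= height_at u z c)%E by apply: lb; exists c.
rewrite i_semilocal.
apply: lt_le_trans (d_value_gt D_division u_embedding z_param height_ge a i0) _.
apply: supremum_bar_int_ub; exists u, z, i; split=> //; last first.
  by apply: height_at_generator => //; exists b.
(* The element [b] attaining the local height witnesses that [z] is appropriate, as every residue is
   central. *)
split=> //; exists i; split=> //; exists b; first by rewrite residue_center.
exact: delta_neq0.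
Qed.
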